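(* Let $(X,+)$ be an abelian Polish group and let $\mathcal{I}$ be a $\sigma$-ideal on $X$ that contains all singletons, has a Borel base, and has the Weaker Smital Property (WSP). Then $\mathcal{I}$ satisfies the countable chain condition (ccc) or $\mathrm{cov}(\mathcal{I})=\omega_1$.
   Context: $\mathrm{Bor}(X)$ denotes the Borel subsets of $X$. $\mathcal{I}$ has a Borel base if every $I\in\mathcal{I}$ is contained in some $A\in \mathrm{Bor}(X)\cap\mathcal{I}$. A set is $\mathcal{I}$-positive if it is not in $\mathcal{I}$, and $\mathcal{I}$-residual if its complement is in $\mathcal{I}$. $A+B=\{a+b: a\in A, b\in B\}$. WSP: there exists a countable dense set $D\subseteq X$ such that for every $A\in\mathrm{Bor}(X)\setminus\mathcal{I}$ the set $A+D$ is $\mathcal{I}$-residual. ccc: every family of pairwise disjoint Borel $\mathcal{I}$-positive sets is countable. $\mathrm{cov}(\mathcal{I})=\min\{|\mathcal{A}|: \mathcal{A}\subseteq\mathcal{I},\ \bigcup\mathcal{A}=X\}$. *)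

(* Defs.v *)
From mathcomp Require Import all_boot all_order all_algebra.
From mathcomp Require Import all_classical all_reals all_analysis.
From mathcomp Require Import wochoice.

Set Implicit Arguments.
Unset Strict Implicit.
Unset Printing Implicit Defensive.

Import Order.TTheory GRing.Theory Num.Theory.

Local Open Scope classical_set_scope.
Local Open Scope card_scope.
Local Open Scope ring_scope.

Definition separable (X : topologicalType) : Prop :=
  exists D : set X, countable D /\ dense D.

Definition is_metric (R : realType) (X : Type) (d : X -> X -> R) : Prop :=
  [/\ forall x, d x x = 0,
      forall x y, d x y = 0 -> x = y,
      forall x y, d x y = d y x &
      forall x y z, d x z <= d x y + d y z].

Definition metrizes (R : realType) (X : topologicalType) (d : X -> X -> R) :
    Prop :=
  forall x : X,
    nbhs x = filter_from [set e : R | 0 < e] (fun e => [set y | d x y < e]).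

Definition complete_metric (R : realType) (X : topologicalType)
    (d : X -> X -> R) : Prop :=
  forall u : nat -> X,
    (forall e : R, 0 < e ->
       exists N : nat, forall m n, (N <= m)%N -> (N <= n)%N ->
         d (u m) (u n) < e) ->
    exists l : X, u @ \oo --> l.

(* The metric is existentially quantified: being Polish is a property of the
   topology, and no compatibility of the metric with a group law is required. *)
Definition polish (R : realType) (X : topologicalType) : Prop :=
  separable X /\
  exists d : X -> X -> R, [/\ is_metric d, metrizes d & complete_metric d].

Definition borel (X : topologicalType) : set (set X) := <<s open >>.

(* An ideal is not required to be proper. *)
Definition sigma_ideal (X : Type) (I : set (set X)) : Prop :=
  [/\ I set0,
      forall A B : set X, A `<=` B -> I B -> I A &
      forall F : nat -> set X, (forall n, I (F n)) -> I (\bigcup_n F n)].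

Definition has_borel_base (X : topologicalType) (I : set (set X)) : Prop :=
  forall A : set X, I A -> exists B : set X, [/\ borel B, I B & A `<=` B].

Definition positive (X : Type) (I : set (set X)) (A : set X) : Prop := ~ I A.

Definition residual (X : Type) (I : set (set X)) (A : set X) : Prop := I (~` A).

Definition sumset (X : zmodType) (A B : set X) : set X :=
  [set a + b | a in A & b in B].

Definition weaker_smital (X : topologicalZmodType) (I : set (set X)) : Prop :=
  exists D : set X,
    [/\ countable D, dense D &
        forall A : set X, borel A -> positive I A -> residual I (sumset A D)].

Definition ccc (X : topologicalType) (I : set (set X)) : Prop :=
  forall F : set (set X),
    (forall A, F A -> borel A /\ positive I A) -> trivIset F id -> countable F.

Definition ideal_cover (X : Type) (I : set (set X)) (F : set (set X)) : Prop :=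
  F `<=` I /\ \bigcup_(A in F) A = setT.

(* cov(I) = |K|: the cardinal of K is attained by a cover and is minimal. *)
Definition cov_eq (X : Type) (I : set (set X)) (U : Type) (K : set U) : Prop :=
  (exists2 F : set (set X), ideal_cover I F & F #= K) /\
  (forall F : set (set X), ideal_cover I F -> K #<= F).

(* (W, le) has order type omega_1, the first uncountable ordinal. *)
Definition omega1_order (W : Type) (le : rel W) : Prop :=
  [/\ well_order le, ~ countable [set: W] &
      forall x : W, countable [set y : W | le y x /\ y <> x]].

Definition cov_eq_omega1 (X : Type) (I : set (set X)) : Prop :=
  exists (W : Type) (le : rel W), omega1_order le /\ cov_eq I [set: W].

(* Main.v *)
Require Import Defs.
From mathcomp Require Import all_boot all_order all_algebra.
From mathcomp Require Import all_classical all_reals all_analysis.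
From mathcomp Require Import wochoice.

(** Suppose that ccc fails, so that some disjoint family of Borel positive sets
    is uncountable, and let [E] be a subfamily of cardinality omega_1.  For the
    countable dense set [D] of the weaker Smital property, every complement
    [~` (A + D)] with [A] in [E] belongs to [I].  These complements cover [X]:
    a point [x] outside all of them lies in [A + D] for every [A] in [E], which
    gives [d A] in [D] with [x - d A] in [A]; as the members of [E] are pairwise
    disjoint, [d] is injective ([countable_of_common_points]), and [E] would be
    countable.  So [I] has a cover of cardinality at most omega_1.

    Conversely no countable subfamily of [I] covers [X]: otherwise [X] would be
    in [I] and there would be no positive set at all.  Hence every cover is
    uncountable, and omega_1 injects into every uncountable set
    ([omega1_card_le]); this gives both the minimality of omega_1 and the exact
    cardinality of the cover above.

    The order type omega_1 is found inside the uncountable family itself: in a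
    well-ordering, the members of an uncountable set that have only countably
    many predecessors in that set form a copy of omega_1
    ([uncountable_omega1_subset]). *)

Set Implicit Arguments.
Unset Strict Implicit.
Unset Printing Implicit Defensive.

Local Open Scope classical_set_scope.
Local Open Scope card_scope.

Lemma well_order_total (T : Type) (le : rel T) : well_order le -> total le.
Proof.
elim/Peq: T => T in le * => wo x y.
by apply: (@wo_chainW T le predT) => // A _; exact: wo.
Qed.

Lemma well_order_anti (T : Type) (le : rel T) :
  well_order le -> antisymmetric le.
Proof.
elim/Peq: T => T in le * => wo x y.
by apply: (@wo_chain_antisymmetric T le predT) => // A _; exact: wo.
Qed.

Lemma well_order_minimum (T : Type) (le : rel T) (A : set T) :
  well_order le -> A !=set0 ->
  exists2 z, A z & forall x, A x -> le z x.
Proof.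
move=> wo [a Aa]; have [|z [[Az zA] _]] := wo (fun x => `[< A x >]).
  by exists a; exact/asboolP.
by exists z => [|x Ax]; [exact/asboolP|apply: zA; exact/asboolP].
Qed.

Definition predecessors (T : Type) (le : rel T) (x : T) : set T :=
  [set y | le y x /\ y <> x].

Lemma well_order_wf (T : Type) (le : rel T) :
  well_order le -> well_founded (fun y x => y \in predecessors le x).
Proof.
move=> wo x; apply: contrapT => nAx.
have [|z nAz zmin] := @well_order_minimum T le
    [set x | ~ Acc (fun y x => y \in predecessors le x) x] wo; first by exists x.
apply: nAz; constructor=> y /set_mem[leyz neyz]; apply: contrapT => /zmin lezy.
by apply: neyz; apply: (well_order_anti wo); rewrite leyz lezy.
Qed.

(** Well-order the ambient type and let [S] be the points of [F] with only
    countably many predecessors in [F].  Every point of [S] then has countably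
    many predecessors in [S].  If [S] were countable, the least point of [F]
    outside [S] would have all its predecessors from [F] in [S], hence only
    countably many, and would belong to [S]. *)
Lemma uncountable_omega1_subset (T : Type) (F : set T) :
  ~ countable F ->
  exists S : set T, S `<=` F /\ exists le : rel S, omega1_order le.
Proof.
elim/Peq: T => T in F * => ncF.
have [le wo] := well_ordering_principle T.
pose S := [set x | F x /\ countable (F `&` predecessors le x)].
have SF : S `<=` F by move=> x [].
exists S; split=> //; exists (fun x y => le (val x) (val y)); split.
- apply: antisymmetric_well_order => [x y /(well_order_anti wo)/val_inj//|A].
  move=> [a Aa].
  have [|_ [z Az <-] zmin] := @well_order_minimum T le (val @` [set` A]) wo.
    by exists (val a), a.
  by exists z; split=> // x Ax; apply: zmin; exists x.
- rewrite (eq_countable (card_setT S)) => cS.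
  have [|m [Fm nSm] mmin] := @well_order_minimum T le (F `\` S) wo.
    apply/set0P/eqP; rewrite setD_eq0 => FS; apply: ncF.
    by apply: sub_countable cS; exact: subset_card_le.
  apply: nSm; split=> //; apply: sub_countable cS; apply: subset_card_le.
  move=> x [Fx [lexm nexm]]; apply: contrapT => nSx; apply: nexm.
  by apply: (well_order_anti wo); rewrite lexm mmin.
- move=> x; have [_] := set_valP x; apply: sub_countable.
  rewrite -(card_le_eql (inj_card_eq (f := val) _)); last first.
    by move=> ? ? _ _; exact: val_inj.
  apply: subset_card_le => _ [y [leyx neyx] <-]; split.
    exact/SF/set_valP.
  by split=> // /val_inj.
Qed.

(** Transfinite recursion: the values at the predecessors of a point are
    countably many, so a new element of [G] is always available. *)
Lemma omega1_card_le (W : Type) (le : rel W) (U : Type) (G : set U) :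
  omega1_order le -> ~ countable G -> [set: W] #<= G.
Proof.
move=> [wo _ cpred] ncG.
have fresh (x : W) (rec : forall y, y \in predecessors le x -> U) :
    {u | G u /\ forall y yx, rec y yx <> u}.
  apply: cid; apply: contrapT => nofresh; apply: ncG.
  have cT : countable [set: predecessors le x].
    by rewrite (eq_countable (card_setT _)); exact: cpred.
  apply: (sub_countable _ cT).
  apply: (card_le_trans (B := range (fun y : predecessors le x =>
    rec (val y) (valP y)))); last exact: card_image_le.
  apply: subset_card_le => u Gu; apply: contrapT => nu.
  apply: nofresh; exists u; split=> // y yx recy; apply: nu.
  exists (SigSub yx) => //; rewrite -recy /=.
  by congr rec; exact: bool_irrelevance.
pose f := Fix (well_order_wf wo) (fun=> U) (fun x rec => sval (fresh x rec)).
have fE x : f x = sval (fresh x (fun y _ => f y)).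
  rewrite /f Fix_eq// => y g h gh; congr (sval (fresh y _)).
  apply/functional_extensionality_dep => z.
  exact/functional_extensionality_dep.
have fG x : G (f x) by rewrite fE; case: (fresh _ _) => u [].
have fneq y x : le y x -> y <> x -> f y <> f x.
  move=> leyx neyx; rewrite [f x]fE; case: (fresh _ _) => u [_ /= fyu].
  by apply: fyu; apply/mem_set.
have f_inj : {in [set: W] &, injective f}.
  move=> x y _ _ fxy; apply: contrapT => nexy.
  by case/orP: (well_order_total wo x y) => /fneq fle; apply: fle => // /esym.
apply: card_le_trans (_ : f @` [set: W] #<= G).
  by have /card_eqPle[] := inj_card_eq f_inj.
by apply: subset_card_le => _ [x _ <-].
Qed.

Lemma sigma_ideal_bigcup (X : Type) (I : set (set X)) (F : set (set X)) :
  sigma_ideal I -> countable F -> F `<=` I -> I (\bigcup_(A in F) A).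
Proof.
move=> [I0 Isub Ibig] /pfcard_geP[->|[f]] FI; first by rewrite bigcup_set0.
apply: (Isub _ (\bigcup_n f n)); last by move: (Ibig f); apply=> n; exact/FI/funS.
by move=> x [A /(@surj _ _ _ _ f)[n _ <-] Ax]; exists n.
Qed.

(** A countable cover would put the whole space, hence also [A], in [I]. *)
Lemma ideal_cover_uncountable (X : Type) (I : set (set X)) (F : set (set X))
    (A : set X) :
  sigma_ideal I -> positive I A -> ideal_cover I F -> ~ countable F.
Proof.
move=> sI pA [FI FT] cF; apply: pA; have [_ Isub _] := sI.
apply: (Isub _ setT) => //; rewrite -FT; exact: sigma_ideal_bigcup.
Qed.

(** If [x = a + d] with [a] in [A] and [d] in [D], then [d] determines
    [a = x - d], hence also [A], by disjointness. *)
Lemma countable_of_common_points (X : zmodType) (D : set X) (E : set (set X))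
    (x : X) :
  countable D -> trivIset E id -> (forall A, E A -> sumset A D x) ->
  countable E.
Proof.
move=> cD tE xE; have /choice[d dP] (A : set X) :
    exists d, E A -> D d /\ A (x - d)%R.
  have [/xE[a Aa [d Dd adx]]|nEA] := pselect (E A); last by exists 0%R.
  by exists d => _; rewrite -adx GRing.addrK.
apply: sub_countable cD; apply: (card_le_trans (B := d @` E)); last first.
  by apply: subset_card_le => _ [A /dP[] Dd _ <-].
have dinj : {in E &, injective d}.
  move=> A B /set_mem EA /set_mem EB dAB; apply: tE => //.
  by exists (x - d A)%R; split; [case: (dP A EA)|rewrite dAB; case: (dP B EB)].
by have /card_eqPle[] := inj_card_eq dinj.
Qed.

Lemma uncountable_cover (X : zmodType) (I : set (set X)) (D : set X)
    (E : set (set X)) :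
  countable D -> trivIset E id -> ~ countable E ->
  (forall A, E A -> residual I (sumset A D)) ->
  ideal_cover I [set ~` sumset A D | A in E].
Proof.
move=> cD tE ncE rE; split=> [_ [A EA <-]|]; first exact: rE.
apply/seteqP; split=> // x _; apply: contrapT => nx; apply: ncE.
apply: (countable_of_common_points (x := x) cD tE) => A EA.
by apply: contrapT => nxA; apply: nx; exists (~` sumset A D) => //; exists A.
Qed.

Theorem theorem8 (R : realType) (X : topologicalZmodType) (I : set (set X)) :
  polish R X ->
  sigma_ideal I ->
  (forall x : X, I [set x]) ->
  has_borel_base I ->
  weaker_smital I ->
  ccc I \/ cov_eq_omega1 I.
Proof.
move=> _ sI _ _ [D [cD _ smital]].
have [|nccc] := pselect (ccc I); [by left|right].
have [F [FP tF ncF]] : exists F : set (set X),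
    [/\ forall A, F A -> borel A /\ positive I A, trivIset F id & ~ countable F].
  apply: contrapT => noF; apply: nccc => F FP tF.
  by apply: contrapT => ncF; apply: noF; exists F.
have [E [EF [le omega1E]]] := uncountable_omega1_subset ncF.
have ncE : ~ countable E.
  by case: omega1E => _ + _; rewrite (eq_countable (card_setT E)).
have coverP C : ideal_cover I C -> [set: E] #<= C.
  move=> coverC; apply: omega1_card_le omega1E _.
  have [F0|/set0P[A /FP[_ pA]]] := eqVneq F set0.
    by case: ncF; rewrite F0.
  exact: ideal_cover_uncountable sI pA coverC.
have coverE : ideal_cover I [set ~` sumset A D | A in E].
  apply: uncountable_cover => //; first exact: sub_trivIset tF.
  by move=> A /EF/FP[bA pA]; exact: smital.
exists E, le; split=> //; split=> //; exists [set ~` sumset A D | A in E] => //.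
apply/card_eqPle; split; last exact: coverP.
by rewrite (card_le_eqr (card_setT E)) card_image_le.
Qed.
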